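(* For all integers $n\ge 0$ and $s\ge 1$, $$a_{n,s}=\sum_{k=0}^{s-1}\binom{n+k}{k}\,y_{n,s-k-1},$$ and conversely, for all integers $n\ge 0$ and $k\ge 0$, $$y_{n,k}=\sum_{j=1}^{k+1}(-1)^{k-j+1}\binom{n+1}{k-j+1}\,a_{n,j}.$$
   Context: A semistandard Young tableau on $s$ symbols of shape $\lambda$ (a Ferrers diagram) is a filling of the cells of $\lambda$ with integers in $\{1,\dots,s\}$ (not necessarily all used), strictly increasing along rows and weakly increasing down columns; $a_{n,s}$ denotes the number of semistandard Young tableaux with $n$ cells on $s$ symbols. A reverse Yamanouchi word is a word $w=w_1\cdots w_n$ with positive integer entries such that for every prefix $w_1\cdots w_m$ and every $i\ge1$, the number of occurrences of $i+1$ in the prefix does not exceed the number of occurrences of $i$. The descent set of a word $w$ is $\{1\le i<n: w_i\ge w_{i+1}\}$, and $d(w)$ is its cardinality. $y_{n,k}$ denotes the number of reverse Yamanouchi words of length $n$ with exactly $k$ descents (so $y_{n,k}=0$ when $k\ge n$ and $n\ge 1$). *)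

(* Defs.v *)
From mathcomp Require Import all_boot.

Set Implicit Arguments.
Unset Strict Implicit.
Unset Printing Implicit Defensive.

(* A partition of n, padded with zeros to exactly n parts: a partition of n    *)
(* has at most n nonzero parts, each of them at most n.                        *)
Definition is_partition (n : nat) (la : {ffun 'I_n -> 'I_n.+1}) : bool :=
  [forall i : 'I_n, forall j : 'I_n, (i <= j) ==> (la j <= la i)]
    && (\sum_(i < n) la i == n).

(* Cells are pairs (row, column), both numbered from 0. *)
Definition diagram (n : nat) (la : {ffun 'I_n -> 'I_n.+1}) :
    {set 'I_n * 'I_n} :=
  [set c : 'I_n * 'I_n | c.2 < la c.1].

Definition cell (n : nat) (la : {ffun 'I_n -> 'I_n.+1}) : finType :=
  {c : 'I_n * 'I_n | c \in diagram la}.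

(* The symbols 1, ..., s are represented by the elements 0, ..., s - 1 of 'I_s *)
(* (only their order matters). Rows increase strictly, columns weakly.         *)
Definition semistandard (n : nat) (la : {ffun 'I_n -> 'I_n.+1}) (s : nat)
    (T : {ffun cell la -> 'I_s}) : bool :=
  [forall c : cell la, forall d : cell la,
     (((val c).1 == (val d).1) && ((val c).2 < (val d).2) ==> (T c < T d))
  && (((val c).2 == (val d).2) && ((val c).1 < (val d).1) ==> (T c <= T d))].

(* a_{n,s} *)
Definition num_ssyt (n s : nat) : nat :=
  \sum_(la : {ffun 'I_n -> 'I_n.+1} | is_partition la)
     #|[set T : {ffun cell la -> 'I_s} | semistandard T]|.

(* The bounds on m and i only serve decidability, see reverse_yamanouchiP. *)
Definition reverse_yamanouchi (w : seq nat) : bool :=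
  all (fun x => 0 < x) w &&
  all (fun m =>
         all (fun i => count_mem i.+1 (take m w) <= count_mem i (take m w))
             (iota 1 (\max_(x <- w) x)))
      (iota 0 (size w).+1).

Lemma reverse_yamanouchiP (w : seq nat) :
  reflect ((forall x, x \in w -> 1 <= x) /\
           (forall m i, 1 <= i ->
              count_mem i.+1 (take m w) <= count_mem i (take m w)))
          (reverse_yamanouchi w).
Proof.
apply: (iffP andP) => [[/allP pos /allP yam]|[pos yam]]; split=> //.
- move=> m i i_gt0.
  wlog le_mw : m / m <= size w => [wl|].
    case: (leqP m (size w)) => [/wl //|/ltnW lt_wm].
    by rewrite take_oversize // -(take_size w); apply: wl.
  have m_in : m \in iota 0 (size w).+1 by rewrite mem_iota add0n ltnS.
  have /allP yam_m := yam _ m_in.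
  case: (leqP i (\max_(x <- w) x)) => [le_i|gt_i].
    by apply: yam_m; rewrite mem_iota i_gt0 add1n ltnS.
  suff /count_memPn -> : i.+1 \notin take m w by [].
  apply/negP => /mem_take i_in.
  have := @leq_bigmax_seq _ w xpredT id _ i_in isT.
  by rewrite leqNgt ltnS (ltnW gt_i).
- exact/allP.
- apply/allP => m _; apply/allP => i; rewrite mem_iota => /andP[i_gt0 _].
  exact: yam.
Qed.

(* No word is lost by taking the letters in 'I_n.+1 in num_yamanouchi. *)
Lemma reverse_yamanouchi_le_size (w : seq nat) :
  reverse_yamanouchi w -> forall x, x \in w -> x <= size w.
Proof.
move/reverse_yamanouchiP=> [pos yam] x x_in.
have all_in i : 1 <= i <= x -> i \in w.
  move=> /andP[i_gt0 le_ix].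
  rewrite -(subKn le_ix) in i_gt0 *.
  have : x - i <= x by apply: leq_subr.
  elim: (x - i) i_gt0 => [|k IHk] pos_k le_kx; first by rewrite subn0.
  have lt_kx : k < x by [].
  have := yam (size w) _ pos_k; rewrite take_size -subSn // subSS => le_c.
  rewrite -has_pred1 has_count; apply: leq_trans le_c.
  by rewrite -has_count has_pred1 IHk ?subn_gt0 // ltnW.
rewrite -[x in x <= _](size_iota 1); apply: uniq_leq_size (iota_uniq _ _) _.
by move=> i; rewrite mem_iota add1n ltnS => /all_in.
Qed.

(* Positions are numbered from 1: w_i is nth 0 w i.-1. *)
Definition descent_set (w : seq nat) : seq nat :=
  [seq i <- iota 1 (size w).-1 | nth 0 w i.-1 >= nth 0 w i].

(* y_{n,k} *)
Definition num_yamanouchi (n k : nat) : nat :=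
  #|[set w : n.-tuple 'I_n.+1 |
       reverse_yamanouchi (map val w) && (size (descent_set (map val w)) == k)]|.

(* Main.v *)
Require Import Defs.
From mathcomp Require Import all_boot all_order all_algebra.
From mathcomp Require Import zify.

(* Record a tableau by the pairs (entry, row) of its cells. Rows being strict,
   these are n distinct pairs, so the tableau is determined by its shape and
   the lexicographically increasing list (c_1, w_1), ..., (c_n, w_n). Columns
   are weakly increasing iff w is a reverse Yamanouchi word, and the list is
   lexicographically increasing iff c is weakly increasing with a strict step
   at each descent of w. For a fixed w with d descents there are
   C(n + s - 1 - d, n) such sequences c, which gives the first formula. It says
   that the sequence s |-> a_{n,s+1} is obtained from k |-> y_{n,k} by taking
   partial sums n + 1 times, so n + 1 backward differences recover y. *)

Set Implicit Arguments.
Unset Strict Implicit.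
Unset Printing Implicit Defensive.

Import Order.Theory GRing.Theory.

(** * Iterated partial sums and differences *)

Section BackwardDifference.

Local Open Scope ring_scope.

Variable R : pzRingType.
Implicit Types (f : nat -> R) (N k : nat).

Definition backward_diff f k : R := f k - (if k is k'.+1 then f k' else 0).

Definition partial_sums f k : R := \sum_(i < k.+1) f i.

Lemma partial_sumsS f k : partial_sums f k.+1 = partial_sums f k + f k.+1.
Proof. exact: big_ord_recr. Qed.

Lemma partial_sumsK f : backward_diff (partial_sums f) =1 f.
Proof.
case=> [|k]; rewrite /backward_diff.
  by rewrite /partial_sums big_ord1 subr0.
by rewrite partial_sumsS addrAC subrr add0r.
Qed.

Lemma iter_partial_sumsK N f :
  iter N backward_diff (iter N partial_sums f) =1 f.
Proof.
elim: N f => [|N IHN] f k //; rewrite iterS iterSr.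
by rewrite -[RHS]partial_sumsK /backward_diff; case: k => [|k]; rewrite !IHN.
Qed.

Lemma iter_backward_diffE N f k :
  iter N backward_diff f k
  = \sum_(i < k.+1) (-1) ^+ i * 'C(N, i)%:R * f (k - i)%N.
Proof.
elim: N k => [|N IHN] k.
  rewrite big_ord_recl big1 => [|i _]; last by rewrite bin0n mulr0 mul0r.
  by rewrite bin0 !mul1r subn0 addr0.
rewrite iterS /backward_diff; case: k => [|k]; rewrite !IHN.
  by rewrite !big_ord1 !bin0 subr0.
rewrite big_ord_recl [RHS]big_ord_recl !bin0 -addrA; congr (_ + _).
rewrite -sumrB; apply: eq_bigr => i _.
by rewrite lift0 subSS binS natrD exprS mulrDr mulrDl !mulN1r !mulNr.
Qed.

Lemma iter_partial_sumsE N f k :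
  iter N.+1 partial_sums f k = \sum_(i < k.+1) 'C(N + i, i)%:R * f (k - i)%N.
Proof.
elim: N k => [|N IHN] k.
  rewrite /= /partial_sums (reindex_inj rev_ord_inj); apply: eq_bigr => i _.
  by rewrite add0n binn mul1r /= subSS.
elim: k => [|k IHk].
  by rewrite iterS /partial_sums big_ord1 IHN !big_ord1 !bin0.
rewrite iterS partial_sumsS -iterS IHk IHN.
rewrite [X in _ + X]big_ord_recl [RHS]big_ord_recl !bin0 addrCA; congr (_ + _).
rewrite -big_split; apply: eq_bigr => i _.
by rewrite lift0 subSS !(addSn, addnS) [in RHS]binS natrD mulrDl addrC.
Qed.

End BackwardDifference.

(** * Enumeration *)

Lemma sum_fibers (I : finType) (P : pred I) (f : I -> nat) (F : nat -> nat) N :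
    (forall i, P i -> N <= f i -> F (f i) = 0) ->
  \sum_(i | P i) F (f i) = \sum_(d < N) F d * #|[set i | P i && (f i == d)]|.
Proof.
move=> F0; under [RHS]eq_bigr do rewrite -sum1dep_card big_mkcondr big_distrr.
rewrite exchange_big; apply: eq_bigr => i Pi /=.
case: (ltnP (f i) N) => [lt_fN|le_Nf].
  rewrite (bigD1 (Ordinal lt_fN)) //= eqxx muln1 big1 ?addn0 // => d.
  by rewrite eq_sym -val_eqE => /negPf /= ->; rewrite muln0.
rewrite F0 // big1 // => d _; rewrite gtn_eqF ?muln0 //.
exact: leq_trans (ltn_ord d) le_Nf.
Qed.

Lemma card_uncurry_bij (A B C : finType) (f : A -> B -> C) (P : pred C) :
  bijective (uncurry f) -> #|[set z | P z]| = \sum_x #|[set y | P (f x y)]|.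
Proof.
move=> f_bij; under eq_bigr do rewrite -sum1dep_card big_mkcond.
rewrite -sum1dep_card big_mkcond pair_big (reindex _ (onW_bij _ f_bij)).
by apply: eq_bigr => -[x y].
Qed.

Lemma card_tuple_cons (T : finType) n (P : pred (n.+1.-tuple T)) :
  #|[set t | P t]| = \sum_x #|[set t : n.-tuple T | P [tuple of x :: t]]|.
Proof.
apply: (card_uncurry_bij (f := fun x (t : n.-tuple T) => [tuple of x :: t])).
exists (fun t => (thead t, [tuple of behead t])) => [[x t]|t] /=.
  by congr (_, _); apply: val_inj.
by rewrite [RHS]tuple_eta; apply: val_inj.
Qed.

Lemma card_tuple_zip (A B : finType) n (P : pred (n.-tuple (A * B))) :
  #|[set t | P t]|
  = \sum_(w : n.-tuple B) #|[set c : n.-tuple A | P [tuple of zip c w]]|.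
Proof.
apply: (card_uncurry_bij
  (f := fun (w : n.-tuple B) (c : n.-tuple A) => [tuple of zip c w])).
exists (fun t : n.-tuple (A * B) =>
  ([tuple of map snd t], [tuple of map fst t])).
  move=> [w c]; congr (_, _); apply: val_inj.
    by apply: unzip2_zip; rewrite !size_tuple.
  by apply: unzip1_zip; rewrite !size_tuple.
by move=> t; apply: val_inj; rewrite /= zip_unzip.
Qed.

Lemma sorted_take_filter_le d (T : porderType d) (t : seq T) m :
  sorted <%O t ->
  take m t = [::] \/ exists p, take m t = [seq x <- t | (x <= p)%O].
Proof.
move=> t_sorted; case: t m t_sorted => [|x0 t] [|m] t_sorted; try by left.
right; exists (nth x0 (x0 :: t) (minn m (size t))).
rewrite filter_le_nth //= ?ltnS ?geq_minr // /minn.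
by case: ltnP => // le_m; rewrite !take_oversize.
Qed.

Lemma card_sets_sorted d (T : finOrderType d) n (P : pred {set T}) :
  #|[set S : {set T} | (#|S| == n) && P S]|
  = #|[set t : n.-tuple T | sorted <%O t && P [set x in t]]|.
Proof.
rewrite -(card_in_imset (f := fun t : n.-tuple T => [set x in t])) => [|t u].
  apply: eq_card => S; rewrite inE; apply/andP/imsetP => [[/eqP cardS PS]|[t]].
    have size_S : size (sort <=%O (enum S)) == n.
      by rewrite size_sort -cardE cardS.
    have setS : [set x in Tuple size_S] = S.
      by apply/setP=> x; rewrite inE mem_sort mem_enum.
    by exists (Tuple size_S); rewrite // inE sort_lt_sorted enum_uniq setS.
  rewrite inE => /andP[t_sorted Pt] ->; split=> //.
  by rewrite cardsE (card_uniqP (lt_sorted_uniq t_sorted)) size_tuple.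
rewrite !inE => /andP[t_sorted _] /andP[u_sorted _] /setP eq_tu.
by apply/val_inj/lt_sorted_eq => // x; have := eq_tu x; rewrite !inE.
Qed.

Lemma card_ord_lt n m : m <= n -> #|[set j : 'I_n | j < m]| = m.
Proof.
move=> le_mn; rewrite -sum1dep_card -(big_ord_widen n (fun=> 1)) //.
by rewrite sum1_card card_ord.
Qed.

Lemma sum_bin_upper n d N : d <= n ->
  \sum_(u < N) 'C(n + u - d, n) = 'C(n + N - d, n.+1).
Proof.
move=> le_dn; elim: N => [|N IHN].
  by rewrite big_ord0 addn0 bin_small // ltnS leq_subr.
by rewrite big_ord_recr /= IHN addnS subSn ?binS // (leq_trans le_dn) ?leq_addr.
Qed.

(** * Descents and lexicographic chains *)

Definition num_descents d (T : porderType d) (p : T) (w : seq T) : nat :=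
  count id (pairmap >=%O p w).

Lemma num_descents_le d (T : porderType d) (p : T) w :
  num_descents p w <= size w.
Proof. by rewrite -[X in _ <= X](size_pairmap >=%O p) count_size. Qed.

Section LexChains.

Context {d : Order.disp_t} {T : orderType d}.
Implicit Types (p x : T).

Lemma ltxi_ord_gap s (u v : 'I_s) p x :
  (((u, p) : 'I_s *l T) < (v, x))%O = (u + (x <= p)%O <= v).
Proof. by rewrite ltxi_pair !leEord ltNge; case: (x <= p)%O; lia. Qed.

Lemma card_lex_chains s n (lo : 'I_s) p (w : n.-tuple T) :
  #|[set c : n.-tuple 'I_s | path (<%O : rel ('I_s *l T)) (lo, p) (zip c w)]|
  = 'C(n + (s - lo.+1) - num_descents p w, n).
Proof.
elim: n lo p w => [|n IHn] lo p w.
  rewrite bin0 -[RHS](expn0 #|'I_s|) -card_tuple.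
  by apply: eq_card => c; rewrite inE [c]tuple0 [w]tuple0.
case/tupleP: w => x w.
rewrite card_tuple_cons /num_descents /= -/(num_descents x w).
set b : nat := (x <= p)%O; set D := num_descents x w.
have le_Dn : D <= n by rewrite -(size_tuple w) num_descents_le.
have first_value v : #|[set c : n.-tuple 'I_s |
    path (<%O : rel ('I_s *l T)) (lo, p) ((v, x) :: zip c w)]|
  = if lo + b <= v then 'C(n + (s - v.+1) - D, n) else 0.
  rewrite /= ltxi_ord_gap -/b -IHn; case: leqP => _ //=.
  by apply: eq_card0 => c; rewrite inE.
under eq_bigr do rewrite first_value.
rewrite -big_mkcond (reindex_inj rev_ord_inj) /=.
rewrite (eq_big (fun u : 'I_s => u < s - lo - b)
   (fun u : 'I_s => 'C(n + u - D, n))) /= => [|u|u _]; last first.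
- by congr 'C(_, _); have := ltn_ord u; lia.
- by have := ltn_ord u; have := leq_b1 (x <= p)%O; rewrite -/b; lia.
rewrite -(big_ord_widen s (fun u => 'C(n + u - D, n))); last by lia.
rewrite sum_bin_upper //; congr 'C(_, _).
have := ltn_ord lo; have := leq_b1 (x <= p)%O; rewrite -/b; lia.
Qed.

End LexChains.

Lemma num_descents_map d d' (T : porderType d) (T' : porderType d')
    (f : T -> T') p w : {mono f : x y / (x <= y)%O} ->
  num_descents (f p) (map f w) = num_descents p w.
Proof.
move=> f_mono; rewrite /num_descents.
by elim: w p => [|x w IHw] p //=; rewrite IHw /Order.ge /= f_mono.
Qed.

Lemma leq_size_descent_set (w : seq nat) : size (descent_set w) <= size w.
Proof.
by rewrite size_filter (leq_trans (count_size _ _)) // size_iota leq_pred.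
Qed.

Lemma size_descent_set_cons (x : nat) (w : seq nat) :
  size (descent_set (x :: w)) = num_descents x w.
Proof.
rewrite /descent_set size_filter /= -(addn0 1) iotaDl count_map.
elim: w x => [|y w IHw] x //=; rewrite /num_descents /=; congr (_ + _).
by rewrite -[RHS]IHw -(addn0 1) iotaDl count_map.
Qed.

Lemma num_descents_ord0 m (w : seq 'I_m.+1) :
  all (ltn 0) (map val w) ->
  num_descents ord0 w = size (descent_set (map val w)).
Proof.
case: w => [|x w] //= /andP[x_gt0 _].
rewrite size_descent_set_cons (@num_descents_map _ _ _ _ val) //.
by rewrite /num_descents /= leEord leqNgt x_gt0.
Qed.

(** * Ballot sets *)

Section Ballot.

Variables s m : nat.
Local Notation point := ('I_s *l 'I_m).
Implicit Types (S : {set point}) (t : seq point) (p x : point).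

Definition row_rank S (i v : nat) : nat :=
  #|[set x in S | (x.1 < v) && (x.2 == i :> nat)]|.

(* Reading S as the pairs (entry, row) of a tableau with rows numbered from 1,
   the second condition says that columns weakly increase. *)
Definition ballot S : bool :=
  [forall x in S, 0 < x.2]
    && [forall v : 'I_s, forall i : 'I_m,
         (0 < i) ==> (row_rank S i.+1 v.+1 <= row_rank S i v.+1)].

Lemma row_rank0 S i : row_rank S i 0 = 0.
Proof. by apply: eq_card0 => x; rewrite !inE ltn0 andbF. Qed.

Lemma row_rank_oversize S i v : m <= i -> row_rank S i v = 0.
Proof.
move=> le_mi; apply: eq_card0 => x; rewrite !inE.
by rewrite [x.2 == _ :> nat]ltn_eqF ?andbF // (leq_trans (ltn_ord _)).
Qed.

Lemma leq_row_rank S i v v' : v <= v' -> row_rank S i v <= row_rank S i v'.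
Proof.
move=> le_v; apply/subset_leq_card/subsetP=> x; rewrite !inE.
by case/and3P=> -> /leq_trans->.
Qed.

Lemma row_rankS S (i : 'I_m) (v : 'I_s) :
  row_rank S i v.+1 = row_rank S i v + ((v, i) \in S).
Proof.
rewrite /row_rank (cardsD1 (v, i)) inE /= ltnSn eqxx !andbT addnC.
congr (_ + _).
apply: eq_card => -[u j]; rewrite !inE xpair_eqE -!val_eqE /= ltnS leq_eqVlt.
by case: (ltngtP u v) => //= _; rewrite ?andbF //; case: eqP; rewrite ?andbF.
Qed.

Lemma row_rank_inj S (i : 'I_m) :
  {in [pred v : 'I_s | (v, i) \in S] &,
    injective (fun v : 'I_s => row_rank S i v)}.
Proof.
move=> v v'; rewrite !inE => v_S v'_S eq_rk.
apply/val_inj; case: (ltngtP v v') => // /(leq_row_rank S i).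
  by rewrite row_rankS v_S eq_rk addn1 ltnn.
by rewrite row_rankS v'_S eq_rk addn1 ltnn.
Qed.

Lemma exists_row_rank S (i : 'I_m) j : j < row_rank S i s ->
  exists2 v : 'I_s, (v, i) \in S & row_rank S i v = j.
Proof.
move=> lt_j; have ex_v : exists v, j < row_rank S i v by exists s.
case: (ex_minnP ex_v) => -[|v] rk_v min_v; first by rewrite row_rank0 in rk_v.
have lt_vs : v < s by apply: min_v.
have := row_rankS S i (Ordinal lt_vs); rewrite /= => rkS.
have rk_le : row_rank S i v <= j.
  by rewrite leqNgt; apply/negP=> /min_v; rewrite ltnn.
exists (Ordinal lt_vs) => /=; last by lia.
by move: rkS; case: (_ \in S) => //; lia.
Qed.

Lemma ballotP S :
  reflect ((forall x, x \in S -> 0 < x.2) /\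
           (forall i v, 0 < i -> v <= s -> row_rank S i.+1 v <= row_rank S i v))
    (ballot S).
Proof.
apply: (iffP andP) => [[/forall_inP pos /forallP rkS]|[pos rkS]]; split=> //.
- move=> i [|v] i_gt0 lt_vs; first by rewrite row_rank0.
  have [lt_im|le_mi] := ltnP i m; last by rewrite row_rank_oversize // leqW.
  by have /forallP/(_ (Ordinal lt_im))/implyP := rkS (Ordinal lt_vs); apply.
- exact/forall_inP.
- by apply/forallP=> v; apply/forallP=> i; apply/implyP=> i_gt0; apply: rkS.
Qed.

Lemma ballot_row_rank S i j v : ballot S ->
  0 < i -> i <= j -> v <= s -> row_rank S j v <= row_rank S i v.
Proof.
case/ballotP=> _ rkS i_gt0 /subnKC <- le_vs.
elim: (j - i) => [|k IHk]; first by rewrite addn0.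
by apply: leq_trans IHk; rewrite addnS rkS // addn_gt0 i_gt0.
Qed.

Lemma count_row_le t p i : uniq t ->
  count_mem i [seq val x.2 | x <- t & (x <= p)%O]
  = row_rank [set x in t] i (p.1 + (i <= p.2)).
Proof.
move=> t_uniq; rewrite count_map count_filter -size_filter.
rewrite -(card_uniqP (filter_uniq _ t_uniq)); apply: eq_card => x.
rewrite !inE mem_filter andbC /= leEprodlexi !leEord; congr (_ && _).
by case: (val x.2 =P i) => [<-|_] /=; rewrite ?andbF // andbT; lia.
Qed.

Lemma ballot_reverse_yamanouchi t : sorted <%O t ->
  ballot [set x in t] = reverse_yamanouchi [seq val x.2 | x <- t].
Proof.
move=> t_sorted; have t_uniq := lt_sorted_uniq t_sorted.
apply/idP/reverse_yamanouchiP => [bal|[pos yam]].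
  have /ballotP[pos rk_le] := bal; split=> [_ /mapP[x x_t ->]|k i i_gt0].
    by apply: pos; rewrite inE.
  rewrite -map_take; have [->|[p ->]] := sorted_take_filter_le k t_sorted => //.
  rewrite !count_row_le //; set v := p.1 + (i < p.2).
  have le_vs : v <= s by rewrite /v; have := ltn_ord p.1; lia.
  apply: leq_trans (rk_le i v i_gt0 le_vs) (leq_row_rank _ _ _).
  by rewrite leq_add2l; case: ltnP => // /ltnW ->.
apply/andP; split.
  by apply/forall_inP=> x; rewrite inE => x_t; apply/pos/map_f.
apply/forallP=> v; apply/forallP=> i; apply/implyP=> i_gt0.
have [lt_i1m|le_mi1] := ltnP i.+1 m; last by rewrite row_rank_oversize.
have t_le_sorted : sorted <=%O t by case/andP: (lt_sorted_is_uniq_le t_sorted).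
have := yam (count (<= (v, Ordinal lt_i1m) :> point)%O t) i i_gt0.
by rewrite -map_take -sorted_filter_le // !count_row_le //= leqnSn leqnn addn1.
Qed.

End Ballot.

Lemma card_sum_row_rank s m (S : {set 'I_s *l 'I_m.+1}) :
  (forall x, x \in S -> 0 < x.2) -> #|S| = \sum_(r < m) row_rank S r.+1 s.
Proof.
move=> pos; rewrite -sum1_card (partition_big (fun x => x.2) xpredT) //=.
rewrite big_ord_recl big1 ?add0n => [|x /andP[/pos + /eqP x2]].
  apply: eq_bigr => r _; rewrite sum1dep_card; apply: eq_card => x.
  by rewrite !inE ltn_ord -val_eqE.
by rewrite x2.
Qed.

(** * Tableaux as ballot sets *)

Section TableauEntries.

Variables (n s : nat) (la : {ffun 'I_n -> 'I_n.+1}).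
Hypothesis la_part : is_partition la.
Implicit Types (T : {ffun cell la -> 'I_s}) (r j : 'I_n) (c d : cell la).
Implicit Types (S : {set 'I_s *l 'I_n.+1}).

Lemma semistandardP T :
  reflect
    ((forall c d,
        (val c).1 = (val d).1 -> (val c).2 < (val d).2 -> T c < T d) /\
     (forall c d,
        (val c).2 = (val d).2 -> (val c).1 < (val d).1 -> T c <= T d))
    (semistandard T).
Proof.
apply: (iffP forallP) => [ssT|[rowT colT] c].
  split=> c d eq_cd lt_cd; have /forallP/(_ d)/andP[rowT colT] := ssT c.
    by apply: (implyP rowT); rewrite eq_cd lt_cd eqxx.
  by apply: (implyP colT); rewrite eq_cd lt_cd eqxx.
apply/forallP=> d; apply/andP; split; apply/implyP=> /andP[/eqP eq_cd lt_cd].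
  exact: rowT.
exact: colT.
Qed.

Lemma cell_col_lt c : (val c).2 < la (val c).1.
Proof. by have := valP c; rewrite inE. Qed.

Lemma cell_eq c d : (val c).1 = (val d).1 -> (val c).2 = (val d).2 -> c = d.
Proof.
move=> eq1 eq2; apply: val_inj.
by rewrite [LHS]surjective_pairing eq1 eq2 -surjective_pairing.
Qed.

(* Positions outside the diagram get the value [s], larger than any symbol. *)
Definition entry_at T r j : nat :=
  if insub (r, j) : option (cell la) is Some c then val (T c) else s.

Lemma entry_at_cell T c : entry_at T (val c).1 (val c).2 = T c.
Proof. by rewrite /entry_at -surjective_pairing valK. Qed.

Lemma entry_at_in T r j : j < la r ->
  exists2 c, val c = (r, j) & entry_at T r j = T c.
Proof.
move=> lt_j; have rj : (r, j) \in diagram la by rewrite inE.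
by exists (Sub (r, j) rj); rewrite // -entry_at_cell.
Qed.

Lemma entry_at_out T r j : la r <= j -> entry_at T r j = s.
Proof. by move=> le_j; rewrite /entry_at insubN // inE -leqNgt. Qed.

Lemma entry_at_lt T r j : (entry_at T r j < s) = (j < la r).
Proof.
case: (ltnP j (la r)) => [/(entry_at_in T)[c _ ->]|/(entry_at_out T) ->].
  exact: ltn_ord.
by rewrite ltnn.
Qed.

Lemma entry_at_le T r j : entry_at T r j <= s.
Proof.
case: (ltnP j (la r)) => [|/entry_at_out-> //].
by rewrite -(entry_at_lt T) => /ltnW.
Qed.

Lemma ltn_entry_at_row T r j j' : semistandard T ->
  j < j' -> j < la r -> entry_at T r j < entry_at T r j'.
Proof.
case/semistandardP=> rowT _ lt_j jr.
case: (ltnP j' (la r)) => [jr'|/(entry_at_out T) ->].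
  have [[c def_c ->] [d def_d ->]] := (entry_at_in T jr, entry_at_in T jr').
  by apply: rowT; rewrite def_c def_d.
by rewrite entry_at_lt.
Qed.

Lemma leq_entry_at_col T r r' j : semistandard T ->
  r <= r' -> entry_at T r j <= entry_at T r' j.
Proof.
case/semistandardP=> _ colT; rewrite leq_eqVlt => /predU1P[/val_inj->//|lt_r].
case: (ltnP j (la r')) => [jr'|/(entry_at_out T) ->]; last exact: entry_at_le.
have jr : j < la r.
  have /andP[/forallP/(_ r)/forallP/(_ r')/implyP le_la _] := la_part.
  by apply: leq_trans jr' (le_la (ltnW lt_r)).
have [[c def_c ->] [d def_d ->]] := (entry_at_in T jr, entry_at_in T jr').
by apply: colT; rewrite def_c def_d.
Qed.

Definition entry_row T c : 'I_s *l 'I_n.+1 := (T c, lift ord0 (val c).1).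

Definition entry_row_set T : {set 'I_s *l 'I_n.+1} :=
  [set entry_row T c | c : cell la].

Lemma entry_row_snd T c : (entry_row T c).2 = (val c).1.+1 :> nat.
Proof. exact: lift0. Qed.

Lemma entry_row_inj T : semistandard T -> injective (entry_row T).
Proof.
case/semistandardP=> rowT _ c d eq_cd.
have eqT : T c = T d := congr1 fst eq_cd.
have eq_r : (val c).1 = (val d).1 := lift_inj (congr1 snd eq_cd).
apply: cell_eq => //; apply/val_inj.
case: (ltngtP (val c).2 (val d).2) => // /rowT lt_T.
  by have := lt_T eq_r; rewrite eqT ltnn.
by have := lt_T (esym eq_r); rewrite eqT ltnn.
Qed.

Lemma row_rank_entry_row_set T r v : semistandard T -> v <= s ->
  row_rank (entry_row_set T) r.+1 v = #|[set j | entry_at T r j < v]|.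
Proof.
move=> ssT le_vs; pose C := [set c | ((val c).1 == r) && (T c < v)].
transitivity #|C|.
  rewrite -(card_imset C (entry_row_inj ssT)); apply: eq_card => x; rewrite inE.
  apply/and3P/imsetP => [[/imsetP[c _ ->]]|[c]].
    rewrite entry_row_snd eqSS val_eqE => lt_v eq_r.
    by exists c; rewrite // inE eq_r.
  by rewrite inE => /andP[/eqP <- lt_v] ->; rewrite entry_row_snd imset_f.
rewrite -(card_in_imset (f := fun c => (val c).2) (D := C)) => [|c d]; last first.
  rewrite !inE => /andP[/eqP rc _] /andP[/eqP rd _].
  by apply: cell_eq; rewrite rc.
apply: eq_card => j; rewrite inE; apply/imsetP/idP => [[c]|lt_v].
  by rewrite inE => /andP[/eqP <- lt_v] ->; rewrite entry_at_cell.
have := leq_trans lt_v le_vs.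
rewrite entry_at_lt => /(entry_at_in T)[c def_c Tc].
by exists c; rewrite ?inE def_c ?eqxx -?Tc.
Qed.

Lemma row_rank_shape T r : semistandard T ->
  row_rank (entry_row_set T) r.+1 s = la r.
Proof.
move=> ssT; rewrite row_rank_entry_row_set // -[RHS](@card_ord_lt n) -1?ltnS //.
by apply: eq_card => j; rewrite !inE entry_at_lt.
Qed.

Lemma row_rank_cell T c : semistandard T ->
  row_rank (entry_row_set T) (val c).1.+1 (T c) = (val c).2.
Proof.
move=> ssT; rewrite row_rank_entry_row_set //; last exact/ltnW.
rewrite -[RHS](@card_ord_lt n); last exact/ltnW.
apply: eq_card => j; rewrite !inE -entry_at_cell.
have lt_c := cell_col_lt c.
case: (ltngtP j (val c).2) => [lt_j|lt_j|/val_inj->]; last by rewrite ltnn.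
  by rewrite ltn_entry_at_row // (ltn_trans lt_j).
by rewrite ltnNge ltnW // ltn_entry_at_row.
Qed.

Lemma card_entry_row_set T : semistandard T -> #|entry_row_set T| = n.
Proof.
move=> ssT; rewrite card_sum_row_rank => [|_ /imsetP[c _ ->] //].
have /andP[_ /eqP sum_la] := la_part; rewrite -[RHS]sum_la.
by apply: eq_bigr => r _; apply: row_rank_shape.
Qed.

Lemma ballot_entry_row_set T : semistandard T -> ballot (entry_row_set T).
Proof.
move=> ssT; apply/ballotP; split=> [_ /imsetP[c _ ->] //|[//|i] v _ le_vs].
have [lt_i1n|le_ni1] := ltnP i.+1 n; last by rewrite row_rank_oversize.
rewrite (row_rank_entry_row_set (Ordinal lt_i1n)) //.
rewrite (row_rank_entry_row_set (Ordinal (ltnW lt_i1n))) //.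
apply/subset_leq_card/subsetP=> j; rewrite !inE.
exact/leq_ltn_trans/leq_entry_at_col.
Qed.

Lemma entry_row_set_inj :
  {in [pred T | semistandard T] &, injective entry_row_set}.
Proof.
move=> T T'; rewrite !inE => ssT ssT' eq_set; apply/ffunP=> c.
apply: (@row_rank_inj _ _ (entry_row_set T) (lift ord0 (val c).1)).
- by rewrite inE; apply: (imset_f (entry_row T)).
- by rewrite inE eq_set; apply: (imset_f (entry_row T')).
- by rewrite lift0 row_rank_cell // eq_set row_rank_cell.
Qed.

Lemma ballot_semistandard S T : ballot S ->
    (forall c, entry_row T c \in S) ->
    (forall c, row_rank S (val c).1.+1 (T c) = (val c).2) ->
  semistandard T.
Proof.
move=> bal T_S rkT; apply/semistandardP; split=> c d eq_cd lt_cd.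
  rewrite ltnNge; apply: contraL lt_cd => le_T.
  by rewrite -leqNgt -(rkT c) -(rkT d) eq_cd leq_row_rank.
rewrite leqNgt; apply/negP=> /(leq_row_rank S (lift ord0 (val d).1)).
rewrite row_rankS T_S addn1 lift0 rkT -eq_cd -(rkT c) ltnNge => /negP[].
by apply: ballot_row_rank => //; apply: ltnW.
Qed.

Lemma entry_row_set_surj S :
    ballot S -> #|S| = n -> (forall r, row_rank S r.+1 s = la r) ->
  exists2 T, semistandard T & entry_row_set T = S.
Proof.
move=> bal cardS shapeS.
have ex_v c : exists v : 'I_s, (v, lift ord0 (val c).1) \in S /\
    row_rank S (val c).1.+1 v = (val c).2.
  have [|v vS <-] := @exists_row_rank s _ S (lift ord0 (val c).1) (val c).2.
    by rewrite lift0 shapeS cell_col_lt.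
  by exists v; rewrite -lift0.
have [f fP] := fin_all_exists ex_v; pose T := [ffun c => f c].
have T_S c : entry_row T c \in S by rewrite /entry_row ffunE; case: (fP c).
have ssT : semistandard T.
  by apply: (ballot_semistandard bal) => // c; rewrite ffunE; case: (fP c).
exists T => //; apply/eqP.
rewrite eqEcard card_entry_row_set // cardS leqnn andbT.
by apply/subsetP=> _ /imsetP[c _ ->].
Qed.

End TableauEntries.

Section BallotShape.

Variables (n s : nat) (S : {set 'I_s *l 'I_n.+1}).
Hypotheses (cardS : #|S| = n) (bal : ballot S).

Definition ballot_shape : {ffun 'I_n -> 'I_n.+1} :=
  [ffun r : 'I_n => inord (row_rank S r.+1 s)].

Lemma ballot_shapeE (r : 'I_n) : ballot_shape r = row_rank S r.+1 s :> nat.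
Proof.
rewrite ffunE inordK // ltnS -[X in _ <= X]cardS.
by apply/subset_leq_card/subsetP=> x; rewrite inE => /andP[].
Qed.

Lemma ballot_shape_partition : is_partition ballot_shape.
Proof.
apply/andP; split.
  apply/forallP=> i; apply/forallP=> j; apply/implyP=> le_ij.
  by rewrite !ballot_shapeE; apply: ballot_row_rank.
have /ballotP[pos _] := bal.
by under eq_bigr do rewrite ballot_shapeE; rewrite -card_sum_row_rank // cardS.
Qed.

End BallotShape.

Lemma num_ssyt_ballot n s :
  num_ssyt n s = #|[set S : {set 'I_s *l 'I_n.+1} | (#|S| == n) && ballot S]|.
Proof.
rewrite -sum1dep_card (partition_big (@ballot_shape n s) (@is_partition n));
  last by move=> S /andP[/eqP]; apply: ballot_shape_partition.
apply: eq_bigr => la la_part; rewrite sum1dep_card.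
rewrite -(card_in_imset (f := @entry_row_set n s la)) => [|T T']; last first.
  by rewrite !inE; apply: entry_row_set_inj.
apply: eq_card => S; rewrite inE.
apply/imsetP/andP => [[T]|[/andP[/eqP cardS bal] /eqP shapeS]].
  rewrite inE => ssT ->; have cardT := card_entry_row_set la_part ssT.
  split; first by rewrite cardT eqxx ballot_entry_row_set.
  apply/eqP/ffunP=> r; apply/val_inj => /=.
  by rewrite ballot_shapeE // row_rank_shape.
have [r|T ssT <-] := entry_row_set_surj la_part bal cardS.
  by rewrite -ballot_shapeE // shapeS.
by exists T; rewrite ?inE.
Qed.

(** * The two formulas *)

Lemma path_lex_ord0 s m (w : seq 'I_m.+1) (c : seq 'I_s.+1) :
  all (ltn 0) (map val w) ->
  path (<%O : rel ('I_s.+1 *l 'I_m.+1)) (ord0, ord0) (zip c w)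
  = sorted (<%O : rel ('I_s.+1 *l 'I_m.+1)) (zip c w).
Proof.
case: w c => [|x w] [|a c] //= /andP[x_gt0 _].
by rewrite ltxi_ord_gap leEord (leqNgt x) x_gt0.
Qed.

Lemma card_lex_sorted s m n (w : n.-tuple 'I_m.+1) : all (ltn 0) (map val w) ->
  #|[set c : n.-tuple 'I_s.+1 |
      sorted (<%O : rel ('I_s.+1 *l 'I_m.+1)) (zip c w)]|
  = 'C(n + s - size (descent_set (map val w)), n).
Proof.
move=> w_pos; rewrite -num_descents_ord0 //.
have := card_lex_chains (ord0 : 'I_s.+1) ord0 w; rewrite subSS subn0 => <-.
by apply: eq_card => c; rewrite !inE path_lex_ord0.
Qed.

Lemma num_ssyt_lex_sorted n s :
  num_ssyt n s = #|[set t : n.-tuple ('I_s *l 'I_n.+1) |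
    sorted <%O t && reverse_yamanouchi [seq val x.2 | x <- t]]|.
Proof.
rewrite num_ssyt_ballot card_sets_sorted; apply: eq_card => t; rewrite !inE.
by case t_sorted: (sorted _ t); rewrite //= ballot_reverse_yamanouchi.
Qed.

Lemma num_ssyt_sum_words n s :
  num_ssyt n s.+1 =
  \sum_(w : n.-tuple 'I_n.+1 | reverse_yamanouchi (map val w))
     'C(n + s - size (descent_set (map val w)), n).
Proof.
rewrite num_ssyt_lex_sorted card_tuple_zip [RHS]big_mkcond.
apply: eq_bigr => w _.
have letters (c : n.-tuple 'I_s.+1) : [seq val x.2 | x <- zip c w] = map val w.
  by rewrite (map_comp val snd) -/(unzip2 _) unzip2_zip ?size_tuple.
case: ifP => [yam|not_yam]; last first.
  by apply: eq_card0 => c; rewrite inE letters not_yam andbF.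
have [pos _] := andP yam; rewrite -card_lex_sorted //.
by apply: eq_card => c; rewrite !inE letters yam andbT.
Qed.

Lemma num_ssyt_sum n s : 0 < s ->
  num_ssyt n s = \sum_(0 <= k < s) 'C(n + k, k) * num_yamanouchi n (s - k - 1).
Proof.
case: s => // s _; rewrite num_ssyt_sum_words big_mkord.
rewrite (sum_fibers (N := s.+1) (F := fun d => 'C(n + s - d, n))) =>
  [|w _ lt_sd].
  rewrite (reindex_inj rev_ord_inj); apply: eq_bigr => k _ /=.
  rewrite subSS subSn ?subn1 -1?ltnS //; congr (_ * _).
  by rewrite -[RHS]bin_sub ?leq_addl // addnK subnBA -1?ltnS // addnAC addnK.
have := leq_size_descent_set (map val w); rewrite size_map size_tuple => le_dn.
rewrite bin_small // ltn_subLR; last exact: leq_trans le_dn (leq_addr _ _).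
by rewrite addnC ltn_add2r.
Qed.

Lemma num_ssyt_iter_partial_sums n s :
  Posz (num_ssyt n s.+1)
  = iter n.+1 (@partial_sums int) (fun k => Posz (num_yamanouchi n k)) s.
Proof.
rewrite iter_partial_sumsE num_ssyt_sum // big_mkord.
rewrite (big_morph Posz PoszD (erefl _)).
by apply: eq_bigr => k _; rewrite PoszM natz subSn ?subn1 // -ltnS.
Qed.

Theorem theorem3 :
  (forall n s : nat, (1 <= s)%N ->
     num_ssyt n s =
       (\sum_(0 <= k < s) 'C(n + k, k) * num_yamanouchi n (s - k - 1))%N)
  /\
  (forall n k : nat,
     ((num_yamanouchi n k)%:Z =
       \sum_(1 <= j < k.+2)
          (-1) ^+ (k.+1 - j) * ('C(n.+1, k.+1 - j))%:Z * (num_ssyt n j)%:Z)%R).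
Proof.
split=> [|n k]; first exact: num_ssyt_sum.
rewrite -(iter_partial_sumsK n.+1 (fun m => Posz (num_yamanouchi n m))).
rewrite iter_backward_diffE big_add1 big_mkord [RHS](reindex_inj rev_ord_inj).
apply: eq_bigr => i _ /=.
by rewrite natz !subSS subKn ?num_ssyt_iter_partial_sums // -ltnS.
Qed.
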